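(* Let $n\ge 1$, let $h\in\mathbb{R}$ with $h\neq 0$, let $K$ be a symmetric real $n\times n$ matrix, and let $V\colon(\mathbb{R}^n)^4\to\mathbb{R}$ be a symmetric $4$-linear form (so that $W(x)=\frac14V(x,x,x,x)$ is a homogeneous quartic potential). The map $(x_0,x_1)\mapsto(x_1,x_2)$ on $\mathbb{R}^{2n}$ in which $x_2$ is determined by $$\frac{x_2-2x_1+x_0}{h^2}=-K\,V(x_0,x_1,x_2,\cdot)$$ has the invariant measure $$(\det M_{01})^{-1}\,dx_{0,1}\wedge\dots\wedge dx_{0,n}\wedge dx_{1,1}\wedge\dots\wedge dx_{1,n},\qquad M_{01}:=I+h^2KV_{01},\quad V_{01}:=V(x_0,x_1,\cdot,\cdot).$$
   Context: $V(x_0,x_1,x_2,\cdot)$ denotes the vector $v\in\mathbb{R}^n$ with $v^\top y=V(x_0,x_1,x_2,y)$ for all $y\in\mathbb{R}^n$. $V(x_0,x_1,\cdot,\cdot)$ denotes the symmetric $n\times n$ matrix $V_{01}$ with $y^\top V_{01}z=V(x_0,x_1,y,z)$ for all $y,z\in\mathbb{R}^n$. The components of $x_j\in\mathbb{R}^n$ are $x_{j,1},\dots,x_{j,n}$. The defining equation of the map is equivalent to $M_{01}x_2=2x_1-x_0$, so the map is a rational map of $\mathbb{R}^{2n}$, defined where $\det M_{01}\neq0$. A rational density $\rho(x_0,x_1)$ times the standard Euclidean volume form is called an invariant measure of the map $\phi\colon(x_0,x_1)\mapsto(x_1,x_2)$ if $\rho(x_1,x_2)\,\det \mathrm{D}\phi(x_0,x_1)=\rho(x_0,x_1)$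 wherever both sides are defined; here $\mathrm{D}\phi$ is the Jacobian matrix of $\phi$. The density may change sign. *)

(* Defs.v *)
From HB Require Import structures.
From mathcomp Require Import all_boot all_order all_algebra all_fingroup.
From mathcomp Require Import all_classical all_reals all_analysis.
From mathcomp.multinomials Require mpoly.
(* The notations of mpoly clash with those of MathComp-Analysis. *)
Import -(notations) mpoly.

Set Implicit Arguments.
Unset Strict Implicit.
Unset Printing Implicit Defensive.

Import Order.TTheory GRing.Theory Num.Theory.
Import numFieldNormedType.Exports.

Local Open Scope classical_set_scope.
Local Open Scope ring_scope.

Section InvariantMeasure.
Variables (R : realType) (m : nat).

(* [f] is the quotient P / Q of two polynomials in the m coordinates, and [D],
   the set where Q does not vanish, is its domain of definition; the values of
   [f] outside [D] are irrelevant. *)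
Definition rational_on (D : set 'rV[R]_m) (f : 'rV[R]_m -> R) : Prop :=
  exists P Q : mpoly.mpoly m R,
    [/\ Q != 0,
        D = [set p | mpoly.meval (fun i => p 0 i) Q != 0] &
        forall p, D p -> f p = mpoly.meval (fun i => p 0 i) P /
                               mpoly.meval (fun i => p 0 i) Q].

(* The measure with rational density [rho] (defined on [Drho]) with respect to
   the Euclidean volume form is invariant under the map [phi] (defined on
   [Dphi]).  MathComp-Analysis acts with Jacobian matrices on row vectors, so
   ['J phi p] is the transpose of the usual Jacobian matrix, with the same
   determinant.  Since ['J phi p] is a default value at points where [phi] is
   not differentiable, differentiability is part of the definition. *)
Definition invariant_measure (Dphi : set 'rV[R]_m) (phi : 'rV[R]_m -> 'rV[R]_m)
    (Drho : set 'rV[R]_m) (rho : 'rV[R]_m -> R) : Prop :=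
  rational_on Drho rho /\
  forall p, Dphi p -> Drho p -> Drho (phi p) ->
    differentiable phi p /\ rho (phi p) * \det ('J phi p) = rho p.

End InvariantMeasure.

Section QuarticMap.
Variables (R : realType) (n : nat).
Local Notation E := 'cV[R]_n.
Local Notation form4 := (E -> E -> E -> E -> R).

Definition four_linear (V : form4) : Prop :=
  [/\ forall b c d, scalar (fun a => V a b c d),
      forall a c d, scalar (fun b => V a b c d),
      forall a b d, scalar (fun c => V a b c d) &
      forall a b c, scalar (fun d => V a b c d)].

Definition symmetric_form4 (V : form4) : Prop :=
  forall (x : 'I_4 -> E) (s : 'S_4),
    V (x (s 0)) (x (s 1)) (x (s 2)) (x (s 3)) = V (x 0) (x 1) (x 2) (x 3).

(* V(x0, x1, x2, .) ; see [Vvec_spec] *)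
Definition Vvec (V : form4) (x0 x1 x2 : E) : E :=
  \col_i V x0 x1 x2 (delta_mx i 0).

(* V(x0, x1, ., .) ; see [Vmat_spec] *)
Definition Vmat (V : form4) (x0 x1 : E) : 'M[R]_n :=
  \matrix_(i, j) V x0 x1 (delta_mx i 0) (delta_mx j 0).

Definition Mmat (h : R) (K : 'M[R]_n) (V : form4) (x0 x1 : E) : 'M[R]_n :=
  1%:M + (h ^+ 2) *: (K *m Vmat V x0 x1).

Definition step_eq (h : R) (K : 'M[R]_n) (V : form4) (x0 x1 x2 : E) : Prop :=
  (h ^+ 2)^-1 *: (x2 - 2 *: x1 + x0) = - (K *m Vvec V x0 x1 x2).

(* A point (x0, x1) of R^{2n} is the row vector [row_mx x0^T x1^T], with
   coordinates x_{0,1}, ..., x_{0,n}, x_{1,1}, ..., x_{1,n} in this order. *)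
Definition pt0 (p : 'rV[R]_(n + n)) : E := (lsubmx p)^T.
Definition pt1 (p : 'rV[R]_(n + n)) : E := (rsubmx p)^T.

Definition qdom (h : R) (K : 'M[R]_n) (V : form4) : set 'rV[R]_(n + n) :=
  [set p | \det (Mmat h K V (pt0 p) (pt1 p)) != 0].

(* (x0, x1) |-> (x1, x2); the default value 0 of [xget] can only occur
   outside [qdom]. *)
Definition qmap (h : R) (K : 'M[R]_n) (V : form4) (p : 'rV[R]_(n + n)) :
    'rV[R]_(n + n) :=
  row_mx (pt1 p)^T (xget 0 [set x2 | step_eq h K V (pt0 p) (pt1 p) x2])^T.

Definition qdensity (h : R) (K : 'M[R]_n) (V : form4) (p : 'rV[R]_(n + n)) : R :=
  (\det (Mmat h K V (pt0 p) (pt1 p)))^-1.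

Lemma scalar_sum_delta (f : E -> R) (y : E) : scalar f ->
  f y = \sum_i y i 0 * f (delta_mx i 0).
Proof.
move=> fL; have f0 : f 0 = 0.
  by have := fL (-1) 0 0; rewrite scaler0 addr0 mulN1r addNr.
have fS (r : seq 'I_n) : f (\sum_(i <- r) y i 0 *: delta_mx i 0) =
    \sum_(i <- r) y i 0 * f (delta_mx i 0).
  by elim: r => [|i r IH]; rewrite ?big_nil // !big_cons fL IH.
rewrite -fS; congr f; rewrite [LHS]matrix_sum_delta.
by apply: eq_bigr => i _; rewrite big_ord1.
Qed.

Lemma Vvec_spec (V : form4) (x0 x1 x2 y : E) : four_linear V ->
  ((Vvec V x0 x1 x2)^T *m y) 0 0 = V x0 x1 x2 y.
Proof.
case=> _ _ _ VL; rewrite (scalar_sum_delta y (VL x0 x1 x2)) mxE.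
by apply: eq_bigr => i _; rewrite !mxE mulrC.
Qed.

Lemma Vmat_spec (V : form4) (x0 x1 y z : E) : four_linear V ->
  (y^T *m Vmat V x0 x1 *m z) 0 0 = V x0 x1 y z.
Proof.
case=> _ _ VL3 VL4; rewrite (scalar_sum_delta z (VL4 x0 x1 y)) mxE.
apply: eq_bigr => j _; rewrite mxE (scalar_sum_delta y (VL3 x0 x1 _)) mulrC.
by congr (_ * _); apply: eq_bigr => i _; rewrite !mxE.
Qed.

End QuarticMap.

(* Main.v *)
Require Import Defs.
From mathcomp Require Import all_boot all_order all_algebra all_fingroup.
From mathcomp Require Import all_classical all_reals all_analysis.
From mathcomp.multinomials Require mpoly.
Import -(notations) mpoly.
Import GRing.Theory Num.Theory.
Import numFieldNormedType.Exports.

(** Write M(a, b) = I + h^2 K V(a, b, ., .).  The defining equation is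
    F := x2 - 2 x1 + x0 + h^2 K V(x0, x1, x2, .) = 0.  Since V is symmetric, the
    trilinear term can be read as linear in x2 with coefficients from (x0, x1),
    or as linear in x0 with coefficients from (x1, x2), so that dF / dx2 is
    M(x0, x1) and dF / dx0 is M(x1, x2).  Implicit differentiation gives

      M(x0, x1) (dx2 / dx0) = - M(x1, x2)          ([derive_sol]).

    The map sends (x0, x1) to (x1, x2), so its Jacobian matrix has the blocks
    0 and I for the component x1, and its determinant is det (- dx2 / dx0)
    ([det_block_ul0]; no sign (-1)^n survives, as the block exchange
    [0, -I; I, 0] has determinant 1).  Hence

      det M(x0, x1) * det D(phi) = det M(x1, x2)   ([det_jacobian]),

    which is the invariance of the density 1 / det M.

    The analytic side conditions come from polynomials: the entries of M, and
    hence those of its adjugate and its determinant, are polynomials in the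
    coordinates ([Mmat_poly_eval]), and x2 is given by Cramer's rule ([sol])
    wherever det M does not vanish, which is an open set ([qdom_near]).
    On this set the map agrees with a rational expression near every point. *)

Set Implicit Arguments.
Unset Strict Implicit.
Unset Printing Implicit Defensive.

Local Open Scope classical_set_scope.
Local Open Scope ring_scope.

(** * Differentiation of matrix-valued functions *)

Section Diff.
Variables (R : realType) (U : normedModType R).

(** Differentiability depends only on the germ; the differential of [f] serves
    as the candidate for [g]. *)
Lemma near_eq_differentiable (W : normedModType R) (f g : U -> W) (x : U) :
  (\near x, f x = g x) -> differentiable f x -> differentiable g x.
Proof.
move=> fg df; have fgx : f x = g x := nbhs_singleton fg.
have gE : g \o shift x = cst (g x) + 'd f x +o_ 0 id.
  apply/eqaddoP => e e0.
  have /eqaddoP/(_ e e0) := diff_locally df.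
  have fg0 : \forall y \near (0 : U), f (y + x) = g (y + x).
    by move: fg; rewrite (near_shift (0 : U)); apply: filterS => y; rewrite /= subr0.
  apply: filterS2 fg0 => y fgy /=.
  by rewrite /= !fctE /= fgy fgx.
have dfc : continuous ('d f x) by exact: diff_continuous.
by apply/diff_locallyP; rewrite (diff_unique dfc gE); split.
Qed.

Lemma differentiable_prod (I : Type) (r : seq I) (f : I -> U -> R) (x : U) :
  (forall i, differentiable (f i) x) ->
  differentiable (fun y => \prod_(i <- r) f i y) x.
Proof.
move=> df; elim: r => [|i r IHr].
  by under eq_fun do rewrite big_nil; exact: differentiable_cst.
under eq_fun do rewrite big_cons.
exact: (differentiableM (df i) IHr).
Qed.

(** A matrix-valued function is a finite combination of constant matrices, with
    its entries as scalar coefficients. *)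
Lemma differentiable_mx m n (f : U -> 'M[R]_(m, n)) (x : U) :
  (forall i j, differentiable (fun y => f y i j) x) -> differentiable f x.
Proof.
move=> df.
have -> : f = \sum_i \sum_j (fun y => f y i j *: delta_mx i j).
  apply/funext => y; rewrite [LHS]matrix_sum_delta fct_sumE.
  by apply: eq_bigr => i _; rewrite fct_sumE.
by do 2![apply: differentiable_sum => ?]; apply: differentiableZl.
Qed.

(** The difference quotient is constant along the line.  This covers functions
    that are multilinear in blocks of variables, along a single block. *)
Lemma is_derive_affine (W : normedModType R) (f : U -> W) (p v : U) (w : W) :
  (forall t, f (t *: v + p) = f p + t *: w) -> is_derive p v f w.
Proof.
move=> fE.
have c : (fun t : R => t^-1 *: ((f \o shift p) (t *: v) - f p)) @ 0^' --> w.
  apply: cvg_near_cst; near=> t; have t0 : t != 0 by near: t; exact: nbhs_dnbhs_neq.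
  by rewrite /= fE addrAC subrr add0r scalerK.
by apply: DeriveDef; [apply/cvg_ex; exists w | exact: cvg_lim c].
Unshelve. all: by end_near. Qed.

Lemma derive_entry m n (f : U -> 'M[R]_(m, n)) (p v : U) i j :
  differentiable f p -> ('D_v f p) i j = 'D_v (fun q => f q i j) p.
Proof. by move=> df; rewrite derive_mx ?mxE //; exact: diff_derivable. Qed.

Lemma differentiable_entry m n (f : U -> 'M[R]_(m, n)) (p : U) i j :
  differentiable f p -> differentiable (fun q => f q i j) p.
Proof.
move=> df; exact: (@differentiable_comp _ _ _ _ f (fun N => N i j) p df
  (differentiable_coord _ i j)).
Qed.

Section Mulmx.
Variables (m n k : nat) (A : U -> 'M[R]_(m, n)) (B : U -> 'M[R]_(n, k)) (p : U).
Hypotheses (dA : differentiable A p) (dB : differentiable B p).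

Let mulmx_entry i l : (fun q => (A q *m B q) i l) =
  \sum_j ((fun q => A q i j) * (fun q => B q j l)).
Proof. by apply/funext => q; rewrite mxE fct_sumE. Qed.

Lemma differentiable_mulmx : differentiable (fun q => A q *m B q) p.
Proof.
apply: differentiable_mx => i l; rewrite mulmx_entry.
by apply: differentiable_sum => j; apply: differentiableM; exact: differentiable_entry.
Qed.

Lemma derive_mulmx (v : U) :
  'D_v (fun q => A q *m B q) p = 'D_v A p *m B p + A p *m 'D_v B p.
Proof.
apply/matrixP => i l.
rewrite derive_entry; last exact: differentiable_mulmx.
rewrite mulmx_entry derive_sum => [|j]; last first.
  by apply: diff_derivable; apply: differentiableM; exact: differentiable_entry.
rewrite !mxE -big_split /=; apply: eq_bigr => j _.
rewrite deriveM; try by apply: diff_derivable; exact: differentiable_entry.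
by rewrite !derive_entry // addrC; congr (_ + _); exact: mulrC.
Qed.
End Mulmx.
End Diff.

Lemma differentiable_meval (R : realType) (m : nat) (P : mpoly m R)
    (p : 'rV[R]_m) : differentiable (fun q : 'rV[R]_m => meval (fun i => q 0 i) P) p.
Proof.
elim/mpolyind: P => [|c u P _ _ dP].
  under eq_fun do rewrite meval0; exact: differentiable_cst.
under eq_fun do rewrite mevalD mevalZ mevalX.
apply: differentiableD => //; apply: differentiableZ.
apply: differentiable_prod => i.
under eq_fun do rewrite -[u i]card_ord -prodr_const.
by apply: differentiable_prod => _; exact: differentiable_coord.
Qed.

(** * A block determinant *)

(** The block exchange [0, -I; I, 0] times the triangular matrix
    [I, B; 0, -A] is this matrix. *)
Lemma det_block_ul0 (R : comPzRingType) n (A B : 'M[R]_n) :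
  \det (block_mx 0 A 1%:M B) = \det (- A).
Proof.
(* The first three factors are the elementary matrices whose product is the
   block exchange. *)
have -> : block_mx 0 A 1%:M B =
    block_mx 1%:M (- 1%:M) 0 1%:M *m block_mx 1%:M 0 1%:M 1%:M
    *m block_mx 1%:M (- 1%:M) 0 1%:M *m block_mx 1%:M B 0 (- A).
  rewrite !mulmx_block !(mul1mx, mulmx1, mul0mx, mulmx0, mulNmx, mulmxN).
  by rewrite ?(addr0, add0r, subrr, opprK, addNr, mul0mx, mul1mx, oppr0,
    mulNmx, mulmxN, subr0, mulmx1).
by rewrite !det_mulmx !det_ublock det_lblock !det1 !mul1r.
Qed.

(** * The equation of the map *)

Section Step.
Variables (R : realType) (n : nat) (h : R) (K : 'M[R]_n).
Variable V : 'cV[R]_n -> 'cV[R]_n -> 'cV[R]_n -> 'cV[R]_n -> R.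
Hypotheses (hVlin : four_linear V) (hVsym : symmetric_form4 V) (hh : h != 0).

Lemma form_swap01 a b c d : V a b c d = V b a c d.
Proof.
have := hVsym (fun i => nth 0 [:: a; b; c; d] i) (tperm 0 1).
by rewrite !permE /=.
Qed.

Lemma form_swap12 a b c d : V a b c d = V a c b d.
Proof.
have := hVsym (fun i => nth 0 [:: a; b; c; d] i) (tperm 1 2).
by rewrite !permE /=.
Qed.

Lemma form_swap23 a b c d : V a b c d = V a b d c.
Proof.
have := hVsym (fun i => nth 0 [:: a; b; c; d] i) (tperm 2 3).
by rewrite !permE /=.
Qed.

Lemma VvecE a b c : Vvec V a b c = Vmat V a b *m c.
Proof.
case: hVlin => _ _ VL _; apply/colP => i; rewrite !mxE (scalar_sum_delta c (VL a b _)).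
by apply: eq_bigr => j _; rewrite mxE form_swap23 mulrC.
Qed.

(** The symmetry on which the invariance rests: the trilinear term can be seen
    as linear in its first argument, with the other two as coefficients. *)
Lemma Vvec_rot a b c : Vvec V a b c = Vvec V b c a.
Proof. by apply/colP => i; rewrite !mxE form_swap01 form_swap12. Qed.

(** This turns the implicit definition of the map into a linear system, the
    unknown being the last argument. *)
Lemma step_eqE a b c : step_eq h K V a b c <-> Mmat h K V a b *m c = 2 *: b - a.
Proof.
have h2 : h ^+ 2 != 0 by rewrite expf_neq0.
rewrite /step_eq VvecE /Mmat mulmxDl mul1mx -scalemxAl -mulmxA.
set w := K *m _; set d := c - _ + _.
have key : c + h ^+ 2 *: w - (2 *: b - a) = d + h ^+ 2 *: w.
  by rewrite opprB addrAC [a - _]addrC addrA.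
split=> [E|E].
  apply/eqP; rewrite -subr_eq0 key -[d](scalerKV h2) E.
  by rewrite scalerN addNr.
have -> : d = - (h ^+ 2 *: w) by apply/eqP; rewrite -addr_eq0 -key E subrr.
by rewrite scalerN scalerK.
Qed.
End Step.

(** * The solution and its Jacobian matrix *)

Section Map.
Variables (R : realType) (n : nat) (h : R) (K : 'M[R]_n).
Variable V : 'cV[R]_n -> 'cV[R]_n -> 'cV[R]_n -> 'cV[R]_n -> R.
Hypotheses (hVlin : four_linear V) (hVsym : symmetric_form4 V) (hh : h != 0).
Local Notation E := 'cV[R]_n.
Local Notation pt := 'rV[R]_(n + n).
Local Notation M p := (Mmat h K V (pt0 p) (pt1 p)).

(** The coordinates of x0 come first, those of x1 last, as in the rows that
    represent points. *)
Definition Vmat_poly : 'M[mpoly (n + n) R]_n :=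
  \matrix_(i, j) \sum_a \sum_b
    mpolyX R (mnm1 (lshift n a)) * (mpolyX R (mnm1 (rshift n b)) *
    mpolyC (n + n) (V (delta_mx a 0) (delta_mx b 0) (delta_mx i 0) (delta_mx j 0))).

Definition Mmat_poly : 'M[mpoly (n + n) R]_n :=
  1%:M + map_mx (@mpolyC (n + n) R) (h ^+ 2 *: K) *m Vmat_poly.

Lemma Vmat_poly_eval (p : pt) :
  map_mx (meval (fun i => p 0 i)) Vmat_poly = Vmat V (pt0 p) (pt1 p).
Proof.
case: hVlin => VL1 VL2 _ _; apply/matrixP => i j; rewrite !mxE rmorph_sum.
rewrite (scalar_sum_delta (pt0 p) (VL1 _ _ _)); apply: eq_bigr => a _.
rewrite (scalar_sum_delta (pt1 p) (VL2 _ _ _)) rmorph_sum mulr_sumr.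
by apply: eq_bigr => b _; rewrite !rmorphM /= !mevalXU (mevalC _ (V _ _ _ _)) !mxE.
Qed.

Lemma Mmat_poly_eval (p : pt) : map_mx (meval (fun i => p 0 i)) Mmat_poly = M p.
Proof.
rewrite /Mmat_poly map_mxD map_mx1 map_mxM Vmat_poly_eval /Mmat scalemxAl.
by congr (_ + _ *m _); apply/matrixP => i j; rewrite !mxE; exact: mevalC.
Qed.

Lemma det_Mmat_poly (p : pt) : meval (fun i => p 0 i) (\det Mmat_poly) = \det (M p).
Proof. by rewrite -Mmat_poly_eval det_map_mx. Qed.

Lemma Mmat0 (b : E) : Mmat h K V 0 b = 1%:M.
Proof.
case: hVlin => VL1 _ _ _; rewrite /Mmat.
suff -> : Vmat V 0 b = 0 by rewrite mulmx0 scaler0 addr0.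
apply/matrixP => i j; rewrite !mxE (scalar_sum_delta 0 (VL1 _ _ _)).
by rewrite big1 // => a _; rewrite mxE mul0r.
Qed.

(** The denominator is not the zero polynomial, since M is the identity at the
    origin. *)
Lemma qdensity_rational : rational_on (qdom h K V) (qdensity h K V).
Proof.
exists 1, (\det Mmat_poly); split.
- apply/eqP => D0; have := det_Mmat_poly 0.
  rewrite D0 meval0 /pt0 linear0 trmx0 Mmat0 det1 => /eqP.
  by rewrite eq_sym oner_eq0.
- by apply/seteqP; split => p; rewrite /qdom /= det_Mmat_poly.
- by move=> p _; rewrite det_Mmat_poly meval1 div1r.
Qed.

Lemma differentiable_Mmat (p : pt) : differentiable (fun q : pt => M q) p.
Proof.
apply: differentiable_mx => i j.
under eq_fun do rewrite -Mmat_poly_eval mxE.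
exact: differentiable_meval.
Qed.

Lemma differentiable_det_Mmat (p : pt) : differentiable (fun q : pt => \det (M q)) p.
Proof.
under eq_fun do rewrite -det_Mmat_poly; exact: differentiable_meval.
Qed.

Lemma differentiable_adj_Mmat (p : pt) : differentiable (fun q : pt => \adj (M q)) p.
Proof.
apply: differentiable_mx => i j.
under eq_fun do rewrite -Mmat_poly_eval -map_mx_adj mxE.
exact: differentiable_meval.
Qed.

Definition rhs (p : pt) : E := 2 *: pt1 p - pt0 p.

Lemma differentiable_rhs (p : pt) : differentiable rhs p.
Proof.
apply: differentiable_mx => i j; under eq_fun do rewrite !mxE.
apply: (@differentiableB _ _ _ (fun q : pt => 2 * q j (rshift n i))
   (fun q : pt => q j (lshift n i))); last exact: differentiable_coord.
by apply: (@differentiableZ _ _ _ (fun q : pt => q j (rshift n i)));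
  exact: differentiable_coord.
Qed.

(** Cramer's rule rather than an inverse matrix: numerator and denominator are
    visibly polynomial, which yields differentiability. *)
Definition sol (p : pt) : E := (\det (M p))^-1 *: (\adj (M p) *m rhs p).

Lemma mul_sol (p : pt) : qdom h K V p -> M p *m sol p = rhs p.
Proof.
by move=> d; rewrite -scalemxAr mulmxA mul_mx_adj mul_scalar_mx scalerK.
Qed.

Lemma differentiable_sol (p : pt) : qdom h K V p -> differentiable sol p.
Proof.
move=> d; apply: differentiable_mx => i j; under eq_fun do rewrite mxE.
apply: (@differentiableM _ _ (fun q : pt => (\det (M q))^-1)
  (fun q : pt => (\adj (M q) *m rhs q) i j)).
  exact: (differentiableV (differentiable_det_Mmat p) d).
apply: differentiable_entry; apply: differentiable_mulmx.
  exact: differentiable_adj_Mmat.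
exact: differentiable_rhs.
Qed.

(** Openness of the domain: derivatives of the map at a point can be computed
    from its expression in terms of [sol]. *)
Lemma qdom_near (p : pt) : qdom h K V p -> \forall q \near p, qdom h K V q.
Proof.
move=> d; have c := differentiable_continuous (differentiable_det_Mmat p).
apply: (c [set x | x != 0]); apply: open_nbhs_nbhs; split; last exact: d.
exact: open_neq.
Qed.

Lemma qmapE (p : pt) : qdom h K V p ->
  qmap h K V p = row_mx (rsubmx p) (sol p)^T.
Proof.
move=> d; rewrite /qmap /pt1 trmxK; congr (row_mx _ _^T).
apply: xget_unique => [|y /(step_eqE K hVlin hVsym hh) My].
  by apply/(step_eqE K hVlin hVsym hh); exact: mul_sol.
have Mu : M p \in unitmx by rewrite unitmxE unitfE.
by rewrite -[y](mulKmx Mu) My -[_ - _](mul_sol d) mulKmx.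
Qed.

Lemma qmap_near (p : pt) : qdom h K V p ->
  \forall q \near p, row_mx (rsubmx q) (sol q)^T = qmap h K V q.
Proof. by move=> /qdom_near; apply: filterS => q d; rewrite qmapE. Qed.

Lemma differentiable_qmap (p : pt) :
  qdom h K V p -> differentiable (qmap h K V) p.
Proof.
move=> d; apply: near_eq_differentiable (qmap_near d) _.
apply: differentiable_mx => i j; under eq_fun do rewrite mxE.
case: (fintype.split j) => k; under eq_fun do rewrite mxE.
  exact: differentiable_coord.
by apply: differentiable_entry; exact: differentiable_sol.
Qed.

(** In the convention of row vectors, v times the Jacobian matrix is the
    derivative along v; its two halves are the variations of x1 and x2. *)
Lemma lsubmx_jacobian (p v : pt) : qdom h K V p ->
  lsubmx (v *m 'J (qmap h K V) p) = rsubmx v.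
Proof.
move=> d; rewrite -deriveEjacobian; last exact: differentiable_qmap.
apply/rowP => j; rewrite mxE derive_entry; last exact: differentiable_qmap.
have : is_derive p v (fun q => qmap h K V q 0 (lshift n j)) (v 0 (rshift n j)).
  apply: (@near_eq_is_derive _ _ _ (fun q : pt => q 0 (rshift n j))).
    by apply: filterS (qdom_near d) => q dq; rewrite qmapE // row_mxEl mxE.
  by apply: is_derive_affine => t; rewrite !mxE addrC.
by case=> _ ->; rewrite mxE.
Qed.

Lemma rsubmx_jacobian (p v : pt) : qdom h K V p ->
  rsubmx (v *m 'J (qmap h K V) p) = ('D_v sol p)^T.
Proof.
move=> d; rewrite -deriveEjacobian; last exact: differentiable_qmap.
apply/rowP => j; rewrite mxE [RHS]mxE.
rewrite (derive_entry _ _ _ (differentiable_qmap d)).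
rewrite (derive_entry _ _ _ (differentiable_sol d)).
apply: near_eq_derive.
by apply: filterS (qdom_near d) => q dq; rewrite qmapE // row_mxEr mxE.
Qed.

Lemma derive_Mmat (p : pt) (u : 'rV[R]_n) :
  'D_(row_mx u 0) (fun q : pt => M q) p = h ^+ 2 *: (K *m Vmat V u^T (pt1 p)).
Proof.
have := @is_derive_affine R pt _ (fun q => M q) p (row_mx u 0)
  (h ^+ 2 *: (K *m Vmat V u^T (pt1 p))).
case=> // t; rewrite /Mmat -addrA; congr (_ + _).
rewrite [X in _ = _ + X]scalerA [t * _]mulrC -[X in _ = _ + X]scalerA -scalerDr.
congr (_ *: _).
rewrite scalemxAr -mulmxDr; congr (_ *m _).
rewrite /pt0 /pt1 !linearD !linearZ /= row_mxKl row_mxKr trmx0 scaler0 add0r.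
case: hVlin => VL1 _ _ _.
by apply/matrixP => i j; rewrite !mxE VL1 addrC.
Qed.

Lemma derive_rhs (p : pt) (u : 'rV[R]_n) : 'D_(row_mx u 0) rhs p = - u^T.
Proof.
have := @is_derive_affine R pt _ rhs p (row_mx u 0) (- u^T).
case=> // t; rewrite /rhs /pt0 /pt1 !linearD !linearZ /= row_mxKl row_mxKr.
by rewrite trmx0 !scaler0 add0r addrA addrAC.
Qed.

(** Differentiate M(x0, x1) x2 = 2 x1 - x0 along (u, 0).  The term coming from
    M is h^2 K V(u, x1, x2, .), and by symmetry it combines with the right-hand
    side -u into - M(x1, x2) u. *)
Lemma derive_sol (p : pt) (u : 'rV[R]_n) : qdom h K V p ->
  M p *m 'D_(row_mx u 0) sol p = - (Mmat h K V (pt1 p) (sol p) *m u^T).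
Proof.
move=> d; set v := row_mx u 0.
have E : 'D_v (fun q => M q *m sol q) p = - u^T.
  rewrite -(derive_rhs p); apply: near_eq_derive.
  by apply: filterS (qdom_near d) => q; exact: mul_sol.
move: E; rewrite derive_mulmx; [|exact: differentiable_Mmat|exact: differentiable_sol].
rewrite derive_Mmat -scalemxAl -mulmxA -VvecE // Vvec_rot // VvecE //.
rewrite addrC => /(canRL (addrK _)) ->.
by rewrite /Mmat mulmxDl mul1mx -scalemxAl mulmxA opprD.
Qed.

(** Up to transposition, the upper right block of the Jacobian matrix is
    dx2 / dx0; multiplying its opposite by M(x0, x1) gives M(x1, x2), and
    determinants are multiplicative. *)
Lemma det_jacobian (p : pt) : qdom h K V p ->
  \det (M p) * \det ('J (qmap h K V) p) = \det (Mmat h K V (pt1 p) (sol p)).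
Proof.
move=> d; set J := 'J _ _.
have J_l (v : pt) : lsubmx (v *m J) = rsubmx v by exact: lsubmx_jacobian.
have Jul : ulsubmx J = 0.
  apply/row_matrixP => i; rewrite rowE -[ulsubmx J]/(lsubmx (usubmx J)).
  have := J_l (row_mx 'e_i 0).
  rewrite -[J in LHS]vsubmxK mul_row_col mul0mx addr0 row_mxKr.
  by rewrite row0 => <-; rewrite -[usubmx J in RHS]hsubmxK mul_mx_row row_mxKl.
have Jdl : dlsubmx J = 1%:M.
  apply/row_matrixP => i; rewrite !rowE mulmx1.
  have := J_l (row_mx 0 'e_i).
  rewrite -[J in LHS]vsubmxK mul_row_col mul0mx add0r row_mxKr.
  by rewrite -[dsubmx J in LHS]hsubmxK mul_mx_row row_mxKl.
have Jur : M p *m (- (ursubmx J)^T) = Mmat h K V (pt1 p) (sol p).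
  apply: trmx_inj; apply/row_matrixP => i; rewrite !rowE.
  rewrite trmx_mul linearN /= trmxK mulNmx mulmxN mulmxA.
  have <- : rsubmx (row_mx 'e_i (0 : 'rV_n) *m J) = 'e_i *m ursubmx J.
    rewrite -[J in LHS]vsubmxK mul_row_col mul0mx addr0.
    by rewrite -[usubmx J in LHS]hsubmxK mul_mx_row row_mxKr.
  rewrite rsubmx_jacobian // -trmx_mul derive_sol //.
  by rewrite [(- _)^T]linearN opprK /= trmx_mul trmxK.
rewrite -[J]submxK Jul Jdl det_block_ul0 -Jur det_mulmx.
by congr (_ * _); rewrite -[LHS]det_tr linearN.
Qed.
End Map.

Theorem proposition1 (R : realType) (n : nat) (hn : (1 <= n)%N)
    (h : R) (hh : h != 0)
    (K : 'M[R]_n) (hK : K^T = K)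
    (V : 'cV[R]_n -> 'cV[R]_n -> 'cV[R]_n -> 'cV[R]_n -> R)
    (hVlin : four_linear V) (hVsym : symmetric_form4 V) :
  invariant_measure (qdom h K V) (qmap h K V) (qdom h K V) (qdensity h K V).
Proof.
split; first exact: qdensity_rational.
move=> p d _ dphi; split; first exact: differentiable_qmap.
have E := det_jacobian hVlin hVsym hh d.
have phiE : Mmat h K V (pt0 (qmap h K V p)) (pt1 (qmap h K V p)) =
    Mmat h K V (pt1 p) (sol h K V p).
  by rewrite qmapE // /pt0 /pt1 row_mxKl row_mxKr trmxK.
move: dphi; rewrite /qdom /= phiE => dphi; rewrite /qdensity phiE.
by apply: (mulfI d); rewrite mulrCA E mulVf // divff.
Qed.
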